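(* Let $X$ be a countable uniformly discrete metric space and let $G$ be a countable group. Then $X$ is uniformly embeddable in $G$ if and only if $X$ is locally uniformly embeddable in $G$.
   Context: Countable groups are regarded as discrete and are equipped with a proper left-invariant metric (unique up to coarse equivalence). A metric space is uniformly discrete if the distances between distinct points are bounded below by a positive constant. A map $\phi\colon X\to Y$ of metric spaces is a uniform embedding if for all $R$ there exists $S$ such that $d(x,y)\le R$ implies $d(\phi(x),\phi(y))\le S$, and for all $R$ there exists $S$ such that $d(\phi(x),\phi(y))\le R$ implies $d(x,y)\le S$; $X$ is uniformly embeddable in $Y$ if such a $\phi$ exists. For a countable uniformly discrete metric space $X$, $\mathrm{Fin}(X)$ is the disjoint union of all finite subsets of $X$, metrized as follows: enumerate the finite subsets as $X_1,X_2,\dots$ and view $\mathrm{Fin}(X)$ as the union of the sets $X_i\times\{i^2\}$ in $X\times\mathbb{N}$ with the metric inherited from the product metric. This metric restricts to the given metric on each $X_i$, and $d(X_i,X_j)\to\infty$ as $i,j\to\infty$ with $i\ne j$; any other metric on $\mathrm{Fin}(X)$ with these properties is coarsely equivalent to it. $X$ is locally uniformly embeddable in $Y$ if $\mathrm{Fin}(X)$ is uniformly embeddable in $\mathrm{Fin}(Y)$.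
   Formalization: The case where G is finite and X is infinite and bounded is excluded, since there X is uniformly embeddable in G by a constant map while Fin(X) is unbounded and Fin(G) is finite, so the equivalence fails. *)

(* Defs.v *)
From HB Require Import structures.
From mathcomp Require Import all_boot all_order all_algebra finmap.
From mathcomp Require Import all_classical all_reals all_analysis.

Set Implicit Arguments.
Unset Strict Implicit.
Unset Printing Implicit Defensive.
Import Order.TTheory GRing.Theory Num.Theory.

Local Open Scope classical_set_scope.
Local Open Scope ring_scope.

(* The two structures are independent of each other here; their compatibility
   is expressed by [left_invariant] and [proper_discrete] below. *)
#[short(type="metricGroupType")]
HB.structure Definition MetricGroup (R : numDomainType) :=
  { G of Group G & Metric R G }.

Definition left_invariant (R : realType) (G : metricGroupType R) : Prop :=
  forall g x y : G, mdist (g * x)%g (g * y)%g = mdist x y.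

(* A countable group carries the discrete topology, so that its compact sets
   are the finite ones: properness says that closed balls are finite. *)
Definition proper_discrete (R : realType) (X : metricType R) : Prop :=
  forall (x : X) (r : R), finite_set [set y : X | mdist x y <= r].

Definition uniformly_discrete (R : realType) (X : metricType R) : Prop :=
  exists2 e : R, 0 < e & forall x y : X, x <> y -> e <= mdist x y.

(* Used to exclude one degenerate case. If G is a finite group and X is infinite
   and bounded (for instance, all distances are 1), any map from X to G is a
   uniform embedding, whereas Fin X is unbounded and Fin G is finite. *)
Definition bounded_space (R : realType) (X : metricType R) : Prop :=
  exists r : R, forall x y : X, mdist x y <= r.

Definition uniform_embedding (R : realType) (X Y : metricType R)
    (phi : X -> Y) : Prop :=
  (forall r : R, exists s : R, forall x y : X,
     mdist x y <= r -> mdist (phi x) (phi y) <= s) /\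
  (forall r : R, exists s : R, forall x y : X,
     mdist (phi x) (phi y) <= r -> mdist x y <= s).

Definition uniformly_embeddable (R : realType) (X Y : metricType R) : Prop :=
  exists phi : X -> Y, uniform_embedding phi.

(* An enumeration X_1, X_2, ... without repetition of all the finite subsets
   of X, given by the map sending a subset A to the index i with X_i = A. The
   set of indices is an initial segment of {1, 2, ...}: all of it if X is
   infinite, and {1, ..., 2 ^ n} if X has n points. *)
Record fset_enumeration (X : choiceType) := FsetEnumeration {
  fset_index :> {fset X} -> nat ;
  fset_index_inj : injective fset_index ;
  fset_index_gt0 : forall A, (0 < fset_index A)%N ;
  fset_index_initial : forall A n, (0 < n <= fset_index A)%N ->
    exists B, fset_index B = n }.

(* The disjoint union of the finite subsets of X; the point x of the copy of
   X_i is [Tagged _ x]. The enumeration [e] only serves to define the metric. *)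
Definition Fin (R : realType) (X : metricType R) (e : fset_enumeration X)
  : Type := {A : {fset X} & A}.

Section FinMetric.
Context (R : realType) (X : metricType R) (e : fset_enumeration X).
Implicit Types p q : Fin e.

HB.instance Definition _ := Choice.on (Fin e).

Definition fin_pt p : X := val (tagged p).

Definition fin_level p : R := (e (tag p) ^ 2)%N%:R.

(* The metric that Fin X inherits from X * nat, the points of the copy of X_i
   being placed at height i ^ 2; the product has the maximum metric, and nat
   the metric |m - n|. (The metric structure that the library puts on nat is
   the discrete one, which is bounded.) *)
Definition fin_dist p q : R :=
  Num.max (mdist (fin_pt p) (fin_pt q)) `|fin_level p - fin_level q|.

Let fin_distxx p : fin_dist p p = 0.
Proof. by rewrite /fin_dist mdistxx subrr normr0 maxxx. Qed.

Let fin_dist_positivity p q : fin_dist p q = 0 -> p = q.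
Proof.
move=> pq0; have : fin_dist p q <= 0 by rewrite pq0.
rewrite /fin_dist ge_max => /andP[d0]; rewrite normr_le0 subr_eq0.
rewrite /fin_level eqr_nat eqn_exp2r// => /eqP /(@fset_index_inj _ e) AB.
have xy : fin_pt p = fin_pt q.
  by apply: mdist_positivity; apply/eqP; rewrite eq_le d0 mdist_ge0.
case: p q AB xy {pq0 d0} => [A x] [B y]; rewrite /fin_pt/= => AB.
by case: _ / AB y => y /val_inj ->.
Qed.

Let fin_dist_sym p q : fin_dist p q = fin_dist q p.
Proof. by rewrite /fin_dist metric_sym distrC. Qed.

Let fin_dist_triangle q p r : fin_dist p r <= fin_dist p q + fin_dist q r.
Proof.
rewrite /fin_dist ge_max; apply/andP; split.
  by rewrite (le_trans (metric_triangle _ (fin_pt q) _))// lerD// le_max lexx.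
by rewrite (le_trans (ler_distD (fin_level q) _ _))// lerD// le_max lexx orbT.
Qed.

HB.instance Definition _ := @isMetric.Build R (Fin e) fin_dist
  fin_distxx fin_dist_positivity fin_dist_sym fin_dist_triangle.

Lemma fin_mdistE p q : mdist p q = fin_dist p q.
Proof. by []. Qed.

End FinMetric.

Lemma fset_enumeration_exists (X : choiceType) :
  countable [set: X] -> inhabited (fset_enumeration X).
Proof.
move=> /countable_injP[f finj]; have cF : countable [set: {fset X}].
  have [g ginj] : exists g : {fset X} -> {fset nat}, injective g.
    exists (fun A => [fset f x | x in A])%fset => A B AB.
    apply/fsetP => x; have fI y z : f y = f z -> y = z.
      by apply: finj; rewrite inE.
    by move/fsetP/(_ (f x)): AB; rewrite !mem_imfset.
  apply/countable_injP; exists (choice.pickle \o g) => A B _ _.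
  by move=> /(pcan_inj choice.pickleK) /ginj.
have mk (h : {fset X} -> nat) : injective h ->
    (forall A n, (n <= h A)%N -> exists B, h B = n) ->
    inhabited (fset_enumeration X).
  move=> hI hS; split; apply: (@FsetEnumeration X (fun A => (h A).+1)) => //.
    by move=> A B [] /hI.
  by move=> A [//|n] /= /hS[B <-]; exists B.
have [/finite_setP[n]|] := pselect (finite_set [set: {fset X}]).
  move=> /card_set_bijP[h [hf hi hs]]; apply: (mk h).
    by move=> A B; apply: hi; rewrite inE.
  move=> A m mA; have [|B _ <-] := hs m; last by exists B.
  exact: leq_ltn_trans mA (hf A I).
move=> /(infiniteP _) iF; have : ([set: {fset X}] #= [set: nat])%card.
  by rewrite card_eq_le; apply/andP.
move=> /card_set_bijP[h [hf hi hs]]; apply: (mk h).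
  by move=> A B; apply: hi; rewrite inE.
by move=> A m _; have [//|B _ <-] := hs m; exists B.
Qed.

Definition locally_uniformly_embeddable (R : realType) (X Y : metricType R)
    (eX : fset_enumeration X) (eY : fset_enumeration Y) : Prop :=
  uniformly_embeddable (Fin eX) (Fin eY).

(* Main.v *)
Require Import Defs.
From mathcomp Require Import all_boot all_order all_algebra finmap.
From mathcomp Require Import all_classical all_reals all_analysis.
From mathcomp Require Import zify.

Set Implicit Arguments.
Unset Strict Implicit.
Unset Printing Implicit Defensive.
Import Order.TTheory GRing.Theory Num.Theory.

Local Open Scope classical_set_scope.

(** In [Fin X], bounded distances between different pieces involve only the
    finitely many points of the pieces of small index ([fin_far_pieces]), and
    distances within a piece are those of [X].  Both directions rest on this.

    From global to local, let [phi : X -> G] be a uniform embedding with [G]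
    infinite.  Each finite subset [A] of [X] can be given a finite superset
    [J A] of its image in such a way that [J] is injective
    ([injective_superset_choice]); then [phi], seen as a map from the piece [A]
    to the piece [J A], is a uniform embedding of [Fin X] in [Fin G]
    ([embeddable_Fin]).  If [G] is finite, then [X] is bounded, hence finite, so
    [Fin X] is bounded and any constant map is a uniform embedding.

    From local to global, let [Phi : Fin X -> Fin G] be a uniform embedding,
    with [X] unbounded, a constant map being enough otherwise.  Fix a base point
    [x0] of [X].  For a finite subset [A] containing [x0], composing [Phi] on the
    piece [A] with the translation that brings the image of [x0] to [1] gives a
    map from [A] to [G].  Closed balls of [G] being finite, such a map takes
    finitely many values at a given point when [A] varies, so these maps have a
    pointwise limit along an ultrafilter that contains, for every finite [B],
    the set of all [A] containing [B].  Translations are isometries, so the upper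
    control of [Phi] passes to the limit [phi].  The lower one needs more, since
    [Phi] may tear a piece apart and the points of [G] underlying two different
    pieces may be close: but for given [x] and [y], the images of [x] and [y] lie
    in the same piece of [Fin G] for all but finitely many [A]
    ([embedding_same_piece]), hence for almost all [A] along the ultrafilter. *)

(** * Finite sets, and finite supersets chosen injectively *)

Section FiniteSets.
Local Open Scope ring_scope.

Lemma finite_mdist_bounded (R : realType) (X : metricType R) (S : set X) :
  finite_set S -> exists D : R, forall x y, S x -> S y -> mdist x y <= D.
Proof.
move=> /[dup] fS /(finite_setX fS) /finite_fsetP[B SB].
exists (\sum_(z <- B) mdist z.1 z.2) => x y Sx Sy.
have xyB : (x, y) \in B.
  by have : (S `*` S) (x, y) by []; rewrite SB.
rewrite (big_rem _ xyB)/= lerDl sumr_ge0// => z _; exact: mdist_ge0.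
Qed.

Lemma finite_space_bounded (R : realType) (X : metricType R) :
  finite_set [set: X] -> bounded_space X.
Proof. by move=> /finite_mdist_bounded[D DP]; exists D => x y; exact: DP. Qed.

Lemma infinite_fset_notin (T : choiceType) (B : {fset T}) :
  infinite_set [set: T] -> exists x, x \notin B.
Proof.
move=> iT; apply: contrapT => /forallNP allB; apply: iT.
apply: sub_finite_set (finite_fset B) => x _ /=.
by apply/negPn/negP => /allB.
Qed.

Lemma fset_superset_card (T : choiceType) (B : {fset T}) (k : nat) :
  infinite_set [set: T] -> (#|` B| <= k)%N ->
  exists2 C : {fset T}, (B `<=` C)%fset & #|` C| = k.
Proof.
move=> iT; elim: k => [|k IHk].
  by rewrite leqn0 => /eqP B0; exists B.
rewrite leq_eqVlt => /predU1P[Bk|]; first by exists B.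
rewrite ltnS => /IHk[C BC Ck]; have [x xC] := infinite_fset_notin C iT.
exists (x |` C)%fset; last by rewrite cardfsU1 xC Ck.
exact: fsubset_trans BC (fsubsetUr _ _).
Qed.

(** Assigning pairwise different cardinalities to the supersets makes the
    choice injective, whatever overlaps the images [f @` A] have.  The
    cardinality [2 ^ i * (2 * #A + 1)] is large enough to be that of a superset
    and determines the index [i] of [A] as its 2-adic valuation. *)
Lemma injective_superset_choice (X Y : choiceType) (e : fset_enumeration X)
    (f : X -> Y) : infinite_set [set: Y] ->
  exists2 J : {fset X} -> {fset Y}, injective J &
    forall (A : {fset X}) x, x \in A -> f x \in J A.
Proof.
move=> iY; pose k A := (2 ^ e A * (2 * #|` A| + 1))%N.
have kI : injective k.
  move=> A B /(congr1 (logn 2)); rewrite /k !lognM ?expn_gt0 ?addn1//.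
  have odd_part n : logn 2 (2 * n).+1 = 0%N.
    by rewrite logn_coprime// coprime2n /= oddM.
  by rewrite !odd_part !pfactorK// !addn0 => /(@fset_index_inj _ e).
have /choice[J JP] A : exists C : {fset Y},
    (f @` A `<=` C)%fset /\ #|` C| = k A.
  have [|C fC Ck] := @fset_superset_card _ (f @` A)%fset (k A) iY.
    rewrite (leq_trans (leq_imfset_card _ _ _))//= /k.
    by have := expn_gt0 2 (e A); nia.
  by exists C.
exists J => [A B AB|A x xA].
  by apply: kI; rewrite -(JP A).2 AB (JP B).2.
exact: (fsubsetP (JP A).1) (in_imfset _ _ xA).
Qed.

End FiniteSets.

(** * Bounded distances in the disjoint union of the finite subsets *)

Section FinGeometry.
Local Open Scope ring_scope.
Context (R : realType) (X : metricType R) (e : fset_enumeration X).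

Lemma low_index_finite (N : nat) : finite_set [set A | (e A <= N)%N].
Proof.
apply: (@finite_preimage _ _ `I_N.+1 e); last exact: finite_II.
by move=> A B _ _; exact: fset_index_inj.
Qed.

Lemma finite_pieces_finite (F : set {fset X}) : finite_set F ->
  finite_set [set p : Fin e | F (tag p)].
Proof.
move=> fF; pose piece (A : {fset X}) : set (Fin e) :=
  (fun x : A => Tagged (fun A : {fset X} => A : Type) x) @` setT.
have : finite_set (\bigcup_(A in F) piece A).
  by apply: bigcup_finite => // A _; exact/finite_image/finite_finset.
by apply: sub_finite_set => -[A x] /= FA; exists A => //; exists x.
Qed.

Lemma Fin_finite : finite_set [set: X] -> finite_set [set: Fin e].
Proof.
move=> /finite_fsetP[B XB].
apply: sub_finite_set (finite_pieces_finite (finite_fset (fpowerset B))).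
move=> [A x] _ /=; rewrite fpowersetE; apply/fsubsetP => y _.
by have : [set: X] y by []; rewrite XB.
Qed.

Lemma fin_pt_le (p q : Fin e) : mdist (fin_pt p) (fin_pt q) <= mdist p q.
Proof. by rewrite fin_mdistE le_max lexx. Qed.

Lemma fin_mdist_same (p q : Fin e) : tag p = tag q ->
  mdist p q = mdist (fin_pt p) (fin_pt q).
Proof.
move=> pq; rewrite fin_mdistE /fin_dist /fin_level pq subrr normr0.
exact/max_idPl/mdist_ge0.
Qed.

(** The gaps between consecutive squares grow, so a bounded jump from one piece
    to another can only occur among the finitely many pieces of small index. *)
Lemma fin_far_pieces (r : R) : exists N : nat, forall p q : Fin e,
  mdist p q <= r -> tag p <> tag q ->
  (e (tag p) <= N)%N /\ (e (tag q) <= N)%N.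
Proof.
have gap (N i j : nat) : `|(i ^ 2)%:R - (j ^ 2)%:R : R| <= N%:R -> i != j ->
    (i <= N)%N /\ (j <= N)%N.
  wlog ij : i j / (i < j)%N => [hw + |].
    move=> h ne; case: (ltnP i j) => [ij|ji]; first exact: hw.
    by apply/and_comm; apply: hw; [lia | rewrite distrC | rewrite eq_sym].
  rewrite distrC -natrB ?leq_exp2r ?(ltnW ij)// normr_nat ler_nat => + _.
  by rewrite !expnS !expn0 !muln1; nia.
(* [gap] holds because j ^ 2 - i ^ 2 >= i + j as soon as i < j. *)
exists (Num.truncn r).+1 => p q pq tpq; apply: gap.
  rewrite (le_trans _ (le_trans pq _))//; first by rewrite le_max lexx orbT.
  exact/ltW/truncnS_gt.
by apply/eqP => /(@fset_index_inj _ e).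
Qed.

End FinGeometry.

(** * From global to local embeddings *)

Section Embeddings.
Local Open Scope ring_scope.
Context (R : realType).

Lemma bounded_embeddable (X Y : metricType R) (y : Y) :
  bounded_space X -> uniformly_embeddable X Y.
Proof.
move=> [D XD]; exists (fun=> y); split=> r; last by exists D.
by exists 0 => *; rewrite mdistxx.
Qed.

Lemma embeddable_bounded (X Y : metricType R) :
  uniformly_embeddable X Y -> bounded_space Y -> bounded_space X.
Proof.
by move=> [phi [_ lo]] [D YD]; have [s sP] := lo D; exists s => x y; exact: sP.
Qed.

(** A uniform embedding [phi] acts on [Fin X] piece by piece, the piece [A]
    being sent into a superset of its image by [phi].  Distances within a piece
    are controlled by [phi]; since different pieces go to different pieces,
    bounded distances between different pieces involve finitely many points
    only, on either side. *)
Lemma embeddable_Fin (X Y : metricType R) (eX : fset_enumeration X)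
    (eY : fset_enumeration Y) : infinite_set [set: Y] ->
  uniformly_embeddable X Y -> uniformly_embeddable (Fin eX) (Fin eY).
Proof.
move=> iY [phi [up lo]].
have [J JI JP] := @injective_superset_choice X Y eX phi iY.
pose Phi (p : Fin eX) : Fin eY :=
  Tagged (fun A : {fset Y} => A : Type) [` JP (tag p) _ (valP (tagged p))]%fset.
have Phi_same (p q : Fin eX) : tag p = tag q ->
    mdist (Phi p) (Phi q) = mdist (phi (fin_pt p)) (phi (fin_pt q)).
  by move=> pq; rewrite fin_mdist_same//= pq.
exists Phi; split=> r.
  have [s sP] := up r; have [N NP] := fin_far_pieces eX r.
  have /(finite_image Phi)/finite_mdist_bounded[D DP] :=
    finite_pieces_finite eX (low_index_finite eX N).
  exists (Num.max s D) => p q pq; rewrite le_max; apply/orP.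
  have [tpq|tpq] := pselect (tag p = tag q).
    by left; rewrite Phi_same//; apply: sP; rewrite -fin_mdist_same.
  by right; have [pN qN] := NP _ _ pq tpq; apply: DP; [exists p|exists q].
have [s sP] := lo r; have [N NP] := fin_far_pieces eY r.
have fJ : finite_set (J @^-1` [set B | (eY B <= N)%N]).
  by apply: finite_preimage (low_index_finite eY N) => A B _ _; exact: JI.
have [D DP] := finite_mdist_bounded (finite_pieces_finite eX fJ).
exists (Num.max s D) => p q pq; rewrite le_max; apply/orP.
have [tpq|tpq] := pselect (tag p = tag q).
  by left; rewrite fin_mdist_same//; apply: sP; rewrite -Phi_same.
by right; have [pN qN] := NP _ _ pq (fun h => tpq (JI _ _ h)); apply: DP.
Qed.

End Embeddings.

(** * Ultrafilters on the finite subsets *)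

Section Ultralimit.

(** The fibres over [S] are finitely many; if the ultrafilter [U] contained the
    complement of each of them, it would contain the empty set.  This replaces
    the extraction of a subsequence along which [f] is constant. *)
Lemma ultra_finite_range (T : Type) (V : choiceType) (U : set_system T)
    (f : T -> V) (S : set V) : UltraFilter U -> finite_set S ->
  U (f @^-1` S) -> exists v, U (f @^-1` [set v]).
Proof.
move=> UU /finite_fsetP[B ->] US; apply: contrapT => /forallNP no.
have nf v : v \in B -> U (~` (f @^-1` [set v])).
  by move=> _; have [/no|] := in_ultra_setVsetC (f @^-1` [set v]) UU.
have UnB : U (\bigcap_(v in [set` B]) ~` (f @^-1` [set v])).
  exact: filter_bigI.
have [t [/= ft nt]] := filter_ex (filterI US UnB).
exact: (nt (f t)).
Qed.

Definition fset_tails (T : choiceType) : set_system {fset T} :=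
  filter_from setT (fun B => [set A | (B `<=` A)%fset]).

Lemma fset_tails_proper (T : choiceType) : ProperFilter (@fset_tails T).
Proof.
apply: filter_from_proper; last by move=> B _; exists B => /=.
apply: filter_from_filter; first by exists fset0.
move=> B C _ _; exists (B `|` C)%fset => // A /=.
by rewrite fsubUset => /andP.
Qed.

Lemma fset_tails_mem (T : choiceType) (x : T) :
  @fset_tails T [set A : {fset T} | x \in A].
Proof. by exists [fset x]%fset => // A /=; rewrite fsub1set. Qed.

(** An infinite set has a point outside the union of the members of [F], and the
    finite subsets containing that point are not in [F]. *)
Lemma fset_tails_avoid (T : choiceType) (F : set {fset T}) :
  infinite_set [set: T] -> finite_set F -> @fset_tails T (~` F).
Proof.
move=> iT /finite_fsetP[E ->].
have [x xE] := infinite_fset_notin (\bigcup_(A <- E) A)%fset iT.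
exists [fset x]%fset => // A /=; rewrite fsub1set => xA AE.
by move/negP: xE; apply; apply/bigfcupP; exists A; rewrite ?AE.
Qed.

End Ultralimit.

(** * From local to global embeddings *)

Section LocalToGlobal.
Local Open Scope ring_scope.
Context (R : realType) (X : metricType R) (eX : fset_enumeration X).

(** The copy of [x] in the piece [A]; adding [x] to [A] makes it total. *)
Definition fin_copy (A : {fset X}) (x : X) : Fin eX :=
  Tagged (fun A : {fset X} => A : Type) [` fset1U1 x A]%fset.

Lemma tag_fin_copy A x : x \in A -> tag (fin_copy A x) = A.
Proof. by move=> xA; apply/mem_fset1U. Qed.

Lemma mdist_fin_copy A x y : x \in A -> y \in A ->
  mdist (fin_copy A x) (fin_copy A y) = mdist x y.
Proof. by move=> xA yA; rewrite fin_mdist_same// !tag_fin_copy. Qed.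

(** If the images of [x] and [y] lie in different pieces, then, being at
    bounded distance, they lie in the bounded part of [Fin Y] made of the pieces
    of small index.  The lower control puts the copies of [x] concerned at
    bounded distance from each other, hence in finitely many pieces. *)
Lemma embedding_same_piece (Y : metricType R) (eY : fset_enumeration Y)
    (Phi : Fin eX -> Fin eY) (x y : X) : uniform_embedding Phi ->
  finite_set [set A : {fset X} | [/\ x \in A, y \in A &
    tag (Phi (fin_copy A x)) <> tag (Phi (fin_copy A y))]].
Proof.
move=> [up lo]; set bad := [set A | _].
have [s sP] := up (mdist x y); have [N NP] := fin_far_pieces eY s.
have [D DP] := finite_mdist_bounded
  (finite_pieces_finite eY (low_index_finite eY N)).
have [S SP] := lo D; have [M MP] := fin_far_pieces eX S.
have [[A0 bad0]|none] := pselect (exists A, bad A); last first.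
  by rewrite (_ : bad = set0)// -subset0 => A bA; apply: none; exists A.
have low A : bad A -> (eY (tag (Phi (fin_copy A x))) <= N)%N.
  move=> [xA yA tA]; apply: (NP _ _ _ tA).1.
  by apply: sP; rewrite mdist_fin_copy.
apply: (@sub_finite_set _ _ (A0 |` [set A | (eX A <= M)%N])).
  move=> A badA; have [->|AA0] := pselect (A = A0); [by left|right].
  have [xA _ _] := badA; have [xA0 _ _] := bad0.
  have /MP : mdist (fin_copy A x) (fin_copy A0 x) <= S.
    by apply: SP; apply: DP; exact: low.
  by rewrite !tag_fin_copy// => /(_ AA0)[].
by rewrite finite_setU; split; [exact: finite_set1|exact: low_index_finite].
Qed.

(** Translating by group elements puts the images of a base point at [1] for all
    finite subsets at once; properness then leaves finitely many values for the
    image of each point, and an ultrafilter finer than the tails of the finite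
    subsets selects one of them coherently. *)
Lemma Fin_embeddable_group (G : metricGroupType R) (eG : fset_enumeration G) :
  left_invariant G -> proper_discrete G -> infinite_set [set: X] -> X ->
  uniformly_embeddable (Fin eX) (Fin eG) -> uniformly_embeddable X G.
Proof.
move=> invG propG iX x0 [Phi PhiE]; have [up lo] := PhiE.
have [U [UU tailsU]] := ultraFilterLemma (fset_tails_proper X).
pose psi x A : G := (((fin_pt (Phi (fin_copy A x0)))^-1)%g *
  fin_pt (Phi (fin_copy A x)))%g.
have memU x : U [set A : {fset X} | x \in A].
  by apply: tailsU; exact: fset_tails_mem.
have psi_dist x y A : mdist (psi x A) (psi y A) =
    mdist (fin_pt (Phi (fin_copy A x))) (fin_pt (Phi (fin_copy A y))).
  exact: invG.
have psi_up r : exists s, forall x y A, x \in A -> y \in A ->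
    mdist x y <= r -> mdist (psi x A) (psi y A) <= s.
  have [s sP] := up r; exists s => x y A xA yA xy.
  rewrite psi_dist (le_trans (fin_pt_le _ _))//.
  by apply: sP; rewrite mdist_fin_copy.
(* The values [psi x A] lie in the ball of centre [1 = psi x0 A] whose radius is
   the upper control evaluated at the distance from [x0] to [x]. *)
have /choice[phi phiU] x : exists g, U (psi x @^-1` [set g]).
  have [s sP] := psi_up (mdist x0 x).
  apply: (ultra_finite_range UU (propG 1%g s)).
  apply: filterS (filterI (memU x0) (memU x)) => A [/= x0A xA].
  by rewrite -(mulVg (fin_pt (Phi (fin_copy A x0)))); exact: sP.
exists phi; split=> r.
  have [s sP] := psi_up r; exists s => x y xy.
  have [A [[/= xA yA] [<- <-]]] := filter_ex
    (filterI (filterI (memU x) (memU y)) (filterI (phiU x) (phiU y))).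
  exact: sP.
have [s sP] := lo r; exists s => x y xy.
have goodU := tailsU _ (fset_tails_avoid iX (embedding_same_piece x y PhiE)).
(* A single [A] of the ultrafilter realizes the limits at [x] and [y] and sends
   both points to the same piece. *)
have [A [[[/= xA yA] good] [xphi yphi]]] := filter_ex (filterI
  (filterI (filterI (memU x) (memU y)) goodU) (filterI (phiU x) (phiU y))).
rewrite -(mdist_fin_copy xA yA); apply: sP; rewrite fin_mdist_same.
  by rewrite -psi_dist xphi yphi.
by apply: contrapT => tA; apply: good.
Qed.

End LocalToGlobal.

Theorem theorem22 (R : realType) (X : metricType R) (G : metricGroupType R)
  (X_countable : countable [set: X])
  (X_discrete : uniformly_discrete X)
  (G_countable : countable [set: G])
  (G_left_invariant : left_invariant G)
  (G_proper : proper_discrete G)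
  (nondegenerate :
     finite_set [set: G] -> bounded_space X -> finite_set [set: X])
  (eX : fset_enumeration X) (eG : fset_enumeration G) :
  uniformly_embeddable X G <-> locally_uniformly_embeddable eX eG.
Proof.
split=> [XG|FXG].
  have [finG|infG] := pselect (finite_set [set: G]); last first.
    exact: embeddable_Fin.
  (* [fin_copy eG fset0 1%g] only witnesses that [Fin G] has a point. *)
  apply: bounded_embeddable (fin_copy eG fset0 1%g) _.
  apply/finite_space_bounded/Fin_finite/nondegenerate => //.
  exact: embeddable_bounded XG (finite_space_bounded finG).
have [bX|ubX] := pselect (bounded_space X).
  exact: bounded_embeddable 1%g bX.
have [[x0]|noX] := pselect (inhabited X); last first.
  by case: ubX; exists 0%R => x; case: noX.
apply: Fin_embeddable_group x0 FXG => //.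
by move=> /finite_space_bounded.
Qed.
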